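(* Let $G$ be a finite group and let $N$ be a normal subgroup of $G$ such that the graph $\Gamma_G(N)$ is connected, regular, and not complete. Then $N/(N\cap \mathbf{Z}(G))$ is a $p$-group for some prime $p$, and $\mathbf{Z}(N)\neq N\cap \mathbf{Z}(G)$.
   Context: For a finite group $G$ and $x\in G$, $x^G$ denotes the conjugacy class of $x$ in $G$, and $\mathbf{Z}(G)$ denotes the center of $G$. For a normal subgroup $N$ of $G$, $\Gamma_G(N)$ is the simple graph whose vertex set is the set of integers $\{|x^G| : x\in N\setminus \mathbf{Z}(G)\}$ (so equal class sizes give a single vertex), where two distinct vertices $v,w$ are adjacent if and only if $\gcd(v,w)>1$. A graph is regular if all its vertices have the same degree, and complete if every two distinct vertices are adjacent. *)

(* Defs.v *)
From HB Require Import structures.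
From mathcomp Require Import all_boot all_fingroup all_solvable.

Set Implicit Arguments.
Unset Strict Implicit.
Unset Printing Implicit Defensive.

Import GroupScope.

(* A finite simple graph is a symmetric irreflexive relation e on a finType. *)

Definition degree (T : finType) (e : rel T) (v : T) : nat := #|[set w | e v w]|.

Definition connected_graph (T : finType) (e : rel T) : Prop :=
  forall v w : T, connect e v w.

Definition regular_graph (T : finType) (e : rel T) : Prop :=
  exists k : nat, forall v : T, degree e v = k.

Definition complete_graph (T : finType) (e : rel T) : Prop :=
  forall v w : T, v != w -> e v w.

Section ClassSizeGraph.

Variables (gT : finGroupType) (G N : {set gT}).

Definition class_sizes : seq nat :=
  undup [seq #|x ^: G| | x in N :\: 'Z(G)].

Definition Gamma_vertex : finType := seq_sub class_sizes.

Definition Gamma : rel Gamma_vertex :=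
  fun v w => (v != w) && (1 < gcdn (val v) (val w))%N.

Lemma class_sizesP (n : nat) :
  reflect (exists2 x, x \in N :\: 'Z(G) & n = #|x ^: G|) (n \in class_sizes).
Proof. by rewrite mem_undup; apply: imageP. Qed.

Lemma Gamma_sym : symmetric Gamma.
Proof. by move=> v w; rewrite /Gamma eq_sym gcdnC. Qed.

Lemma Gamma_irr : irreflexive Gamma.
Proof. by move=> v; rewrite /Gamma eqxx. Qed.

End ClassSizeGraph.

(* Main.v *)
(* Call two noncentral elements of N twins if their class sizes are coprime to
   the same vertices.  Regularity makes elements twins as soon as one class size
   divides the other, and, in the noncomplete case, no vertex is adjacent to all
   the others.  Noncentral commuting p- and r-elements (p <> r) are twins of
   their product.  If all noncentral r-elements were twins, r would divide every
   other vertex, and connectedness would give a universal vertex; hence, by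
   Sylow, r divides the class size of every noncentral p-element, p <> r, as soon
   as N has noncentral r-elements.  It follows that noncentral p- and r-elements
   never commute.  On the other hand, the elements of N whose class size is
   coprime to the largest one generate a nilpotent group, which yields a
   noncentral q-subgroup W of N, normal in G.  For r <> q, a Sylow r-subgroup of N
   acts fixed-point-freely on W modulo the centre, so that all noncentral
   r-elements are twins, a contradiction.  Thus N / (N :&: 'Z(G)) is a q-group.
   Finally, of two coprime vertices one is prime to q, and an element of N with
   that class size is central in N. *)

Require Import Defs.
From mathcomp Require Import all_boot all_fingroup all_solvable.
From mathcomp Require Import ssralg.

Set Implicit Arguments.
Unset Strict Implicit.
Unset Printing Implicit Defensive.

Import GroupScope.

(** * Fixed-point-free action on an abelian group *)

Section FixedPointFree.

Import GRing.Theory FiniteModule.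

Variables (gT : finGroupType) (V : {group gT}) (abV : abelian V) (r : nat).

Implicit Types (a b x : gT) (u : fmod_of abV).

(** Since [a ^+ r = 1], applying [a] permutes the terms cyclically; the sum is thus fixed by [a],
    that is, lies in ['C_V[a]]. *)
Lemma fpf_norm0 a u : a \in 'N(V) -> a ^+ r = 1 -> 'C_V[a] = 1 ->
  (\sum_(i < r) u ^@ (a ^+ i) = 0)%R.
Proof.
move=> nVa ar1 CVa; set s := (\sum_(i < r) _)%R.
have sa : (s ^@ a = s)%R.
  rewrite actr_sum /s; case: r ar1 => [|k] ar1; first by rewrite !big_ord0.
  rewrite big_ord_recr big_ord_recl /= -actrM ?groupX // -expgSr ar1 addrC.
  congr (_ + _)%R; apply: eq_bigr => i _.
  by rewrite -actrM ?groupX // -expgSr.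
apply: val_inj; rewrite fmval0; apply/set1gP; rewrite -CVa.
apply/subcent1P; split; first exact: fmodP.
by apply/commute_sym/commgP/conjg_fixP; rewrite -fmvalJ // sa.
Qed.

(* If [x] is not a power of [b], all [x b^j] are fixed-point-free, so in
   additive notation
   [0 = \sum_(j < r) \sum_(i < r) u ^ (x b^j)^i]; exchanging the sums, the terms
   with [i > 0] add up to norms for [b^i], hence vanish, while [i = 0] leaves
   [r u]. *)
Lemma fpf_cycle x b : prime r -> V :!=: 1 -> coprime r #|V| ->
    x \in 'N(V) -> b \in 'N(V) -> commute x b -> x ^+ r = 1 -> #[b] = r ->
    (forall a, a \in <[x]> * <[b]> -> a != 1 -> 'C_V[a] = 1) ->
  x \in <[b]>.
Proof.
move=> pr_r ntV co_rV nVx nVb cxb xr1 ob fpf; apply: contraR ntV => xNb.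
have br1 : b ^+ r = 1 by rewrite -ob expg_order.
apply/eqP/trivgP/subsetP => v Vv.
suff rv : v ^+ r = 1.
  rewrite inE -order_eq1 -dvdn1 -(eqP co_rV) dvdn_gcd order_dvdn rv eqxx.
  exact: order_dvdG.
pose u := fmod abV v; suff ur : (u *+ r = 0)%R.
  by move/(congr1 val): ur; rewrite fmvalZ fmodK.
have normx (j : 'I_r) : (\sum_(i < r) u ^@ ((x * b ^+ j) ^+ i) = 0)%R.
  apply: fpf_norm0; rewrite ?groupM ?groupX //.
    by rewrite expgMn ?xr1 ?mul1g -?expgM 1?mulnC ?expgM ?br1 ?expg1n //; apply: commuteX.
  apply: fpf; first by rewrite mem_mulg ?cycle_id ?mem_cycle.
  by apply: contra xNb; rewrite -eq_invg_mul => /eqP xVE; rewrite -groupV xVE mem_cycle.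
have : (\sum_(j < r) \sum_(i < r) u ^@ ((x * b ^+ j) ^+ i) = 0)%R.
  by apply: big1.
rewrite exchange_big /= => <-.
have r_gt0 := prime_gt0 pr_r.
rewrite (bigD1 (Ordinal r_gt0)) //= [X in (_ + X)%R]big1 => [|i nz_i].
  under eq_bigr => j _ do rewrite expg0 actr1.
  by rewrite sumr_const card_ord addr0.
rewrite -[RHS](@fpf_norm0 (b ^+ i) (u ^@ (x ^+ i))%R); first last.
- apply: fpf; first by rewrite -[_ ^+ _]mul1g mem_mulg ?mem_cycle.
  rewrite -order_dvdn ob gtnNdvd //.
  by rewrite lt0n; apply: contra nz_i => /eqP i0; apply/eqP/val_inj.
- by rewrite -expgM mulnC expgM br1 expg1n.
- by rewrite groupX.
apply: eq_bigr => j _; rewrite -actrM ?groupX //.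
by rewrite expgMn -?expgM 1?[(j * i)%N]mulnC //; apply: commuteX.
Qed.

End FixedPointFree.

(** * Divisibility and products of conjugacy classes *)

Section ClassSizes.

Variables (gT : finGroupType) (G : {group gT}).

Implicit Types (x y z g : gT) (K N : {group gT}).

Local Notation cs x := #|x ^: G|.

Lemma class_size_dvd x y : 'C_G[x] \subset 'C_G[y] -> cs y %| cs x.
Proof. by move=> sC; rewrite -!index_cent1; apply: indexgS. Qed.

Lemma class_sizeX x n : cs (x ^+ n) %| cs x.
Proof.
by apply: class_size_dvd; rewrite setIS // sub_cent1 groupX // -sub_cent1.
Qed.

Lemma class_size_constt pi x : cs x.`_pi %| cs x.
Proof. exact: class_sizeX. Qed.

Lemma class_sizeJ x g : g \in G -> cs (x ^ g) = cs x.
Proof. by move=> Gg; rewrite classGidl. Qed.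

(** For [C := 'C_G[x]], the left side is the index of [C] in the subgroup [K * C] of [G]. *)
Lemma class_size_normal K x :
  x \in G -> K <| G -> #|x ^: K| %| cs x.
Proof.
move=> Gx /andP[sKG nKG]; rewrite -!index_cent1; set C := 'C_G[x].
have sCG : C \subset G by apply: subsetIl.
have sKC : C \subset K <*> C by apply: joing_subr.
apply: dvdn_trans (indexSg sKC _); last by rewrite join_subG sKG.
have defKC : K <*> C = K * C by rewrite norm_joinEr // (subset_trans sCG).
have -> : 'C_K[x] = K :&: C by rewrite setIA (setIidPl sKG).
rewrite indexgI -(dvdn_pmul2l (cardG_gt0 C)) (Lagrange sKC) /= defKC.
rewrite -(dvdn_pmul2r (cardG_gt0 (K :&: C))) -mul_cardG -mulnA mulnC.
by rewrite [(#|K : C| * _)%N]mulnC LagrangeI.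
Qed.

(** Coprime indices give [G = 'C_G[x] * 'C_G[y]], so [x ^ g] and [y ^ h] can be reached with one
    common conjugating element. *)
Lemma class_mul_coprime x y : x \in G -> y \in G ->
  coprime (cs x) (cs y) -> (x * y) ^: G = x ^: G * y ^: G.
Proof.
move=> Gx Gy; rewrite -!index_cent1 => co.
have defG := coprime_index_mulG (subsetIl _ _) (subsetIl _ _) co.
apply/eqP; rewrite eqEsubset; apply/andP; split; apply/subsetP => z.
  by case/imsetP => g Gg ->; rewrite conjMg mem_mulg ?imset_f.
case/mulsgP => _ _ /imsetP[g Gg ->] /imsetP[h Gh ->] ->.
have : g * h^-1 \in 'C_G[x] * 'C_G[y] by rewrite defG groupM ?groupV.
case/mulsgP=> [a b /subcent1P[Ga xa] /subcent1P[Gb yb] def_gh].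
apply/imsetP; exists (a^-1 * g); first by rewrite groupM ?groupV.
have -> : x ^ g = x ^ (a^-1 * g).
  by rewrite conjgM [x ^ a^-1](conjg_fixP _) //; apply/commgP/commuteV/commute_sym.
have -> : y ^ h = y ^ (a^-1 * g).
  have -> : a^-1 * g = b * h by rewrite -[g](mulgKV h) def_gh !mulgA mulVg mul1g.
  by rewrite conjgM [y ^ b](conjg_fixP _) //; apply/commgP/commute_sym.
by rewrite conjMg.
Qed.

Lemma coprime_class_norm N n : N <| G ->
  G \subset 'N([set d in N | coprime n (cs d)]).
Proof.
case/andP=> _ nNG; apply/normsP => g Gg; apply/eqP.
rewrite eqEcard cardJg leqnn andbT; apply/subsetP => _ /imsetP[d /setIdP[Nd co] ->].
by rewrite inE memJ_norm ?(subsetP nNG) // Nd class_sizeJ.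
Qed.

(* For a class [B = x ^: G] of maximal size and [d] in the generating set, every
   [B d^g] is contained in the class [(x d) ^: G = B * d ^: G], so equals it.
   Hence [B] is stable under right multiplication by [K := [~: D, G]] and [#|K|]
   divides [#|B|], so [K] centralises [D]. *)
Lemma max_class_nilpotent N x : N <| G -> x \in N ->
    {in N, forall y, cs y <= cs x} ->
  nilpotent <<[set d in N | coprime (cs x) (cs d)]>>.
Proof.
move=> nsNG Nx maxx; set D := [set d in N | _]; set B := x ^: G.
have sNG := normal_sub nsNG.
have sDN : D \subset N by apply/subsetP => d /setIdP[].
have sDG := subset_trans sDN sNG; have Gx := subsetP sNG x Nx.
have DV d : d \in D -> d^-1 \in D.
  by rewrite !inE groupV classVg card_invg.
pose K := [~: D, G]%G; pose M := <<D>>%G.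
have Bd d g : d \in D -> g \in G -> B :* d ^ g = (x * d) ^: G.
  case/setIdP=> Nd co Gg; apply/eqP.
  rewrite eqEcard card_rcoset maxx ?groupM // andbT.
  rewrite class_mul_coprime ?(subsetP sNG d) // mulgS // sub1set.
  exact: memJ_class.
have stK : K \subset 'N(B | 'R).
  rewrite gen_subG; apply/subsetP => _ /imset2P[d g Dd Gg ->].
  rewrite !inE /=; apply/subsetP => b Bb; rewrite inE /=.
  have BdV h : h \in G -> B :* d^-1 ^ h = (x * d^-1) ^: G by apply: Bd; apply: DV.
  rewrite commgEl mulgA -[d ^ g]invgK -conjVg -mem_rcoset BdV // -(BdV 1) //.
  by rewrite conjg1 mem_rcoset mulgK.
have dvdK : #|K| %| #|B|.
  rewrite -(acts_sum_card_orbit stK); apply: dvdn_sum => _ /imsetP[b _ ->].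
  by rewrite orbitR card_lcoset.
have nKG : K <| G.
  by rewrite /normal commg_normr andbT (subset_trans (commgSS sDG (subxx G))) ?der1_subG.
have cKM : K \subset 'C(M).
  rewrite centsC gen_subG; apply/subsetP => d Dd; have /setIdP[Nd co] := Dd.
  rewrite -sub_cent1 -[_ \subset _](subsetIidl) -indexg_eq1 index_cent1.
  have Gd := subsetP sDG d Dd.
  (* [#|d ^: K|] divides [#|d ^: G|] as [K] is normal, and [#|B|] through [#|K|]; these are
     coprime. *)
  rewrite -dvdn1 -(eqP co) dvdn_gcd class_size_normal // andbT.
  by apply: dvdn_trans dvdK; rewrite -index_cent1 dvdn_indexg.
have M'K : M^`(1) \subset K.
  have sMG : M \subset G by rewrite gen_subG.
  have [_ nKG'] := andP nKG.
  rewrite (subset_trans (commgS _ sMG)) // -quotient_cents2 ?(subset_trans sMG) //.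
  rewrite quotient_gen ?(subset_trans sDG) // gen_subG.
  exact: quotient_cents2r.
apply: (@small_nil_class _ M); rewrite (@leq_trans 2) // nil_class2 subsetI der_sub.
exact: subset_trans cKM.
Qed.
End ClassSizes.

(** * From the graph to coprimality of class sizes *)

Section Twins.

Variables (gT : finGroupType) (G N : {group gT}).

Implicit Types x y z g : gT.

Local Notation X := (N :\: 'Z(G)).
Local Notation cs x := #|x ^: G|.

(** No vertex is coprime to itself, so for noncentral elements this says that the closed
    neighbourhoods in [Gamma] agree. *)
Definition twin x y :=
  [forall z in X, coprime (cs x) (cs z) == coprime (cs y) (cs z)].

Lemma twinP x y :
  reflect {in X, forall z, coprime (cs x) (cs z) = coprime (cs y) (cs z)}
          (twin x y).
Proof. exact: eqfun_inP. Qed.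

Lemma twin_refl x : twin x x.
Proof. exact/twinP. Qed.

Lemma twin_sym x y : twin x y = twin y x.
Proof. by apply: eq_forallb_in => z _; rewrite eq_sym. Qed.

Lemma twin_trans y x z : twin x y -> twin y z -> twin x z.
Proof. by move=> /twinP xy /twinP yz; apply/twinP => u Xu; rewrite xy ?yz. Qed.

Definition size_vertex x (Xx : x \in X) : Gamma_vertex G N :=
  SeqSub (introT (class_sizesP G N (cs x)) (ex_intro2 _ _ x Xx (erefl _))).

Lemma vertexE (v : Gamma_vertex G N) : exists2 x, x \in X & val v = cs x.
Proof. exact/class_sizesP/valP. Qed.

Hypothesis sNG : N \subset G.

Lemma noncentralG x : x \in X -> x \in G.
Proof. by case/setDP=> Nx _; apply: (subsetP sNG). Qed.

Lemma class_size_eq1 x : x \in G -> (cs x == 1%N) = (x \in 'Z(G)).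
Proof.
by move=> Gx; rewrite -index_cent1 indexg_eq1 subsetI subxx sub_cent1 inE Gx.
Qed.

Lemma class_size_gt1 x : x \in X -> 1 < cs x.
Proof.
move=> Xx; rewrite ltn_neqAle eq_sym class_size_eq1 ?noncentralG //.
by rewrite -index_cent1 indexg_gt0 andbT; case/setDP: Xx.
Qed.

Lemma Gamma_coprime x y (Xx : x \in X) (Xy : y \in X) :
  ~~ coprime (cs x) (cs y) =
  (size_vertex Xx == size_vertex Xy) || Gamma (size_vertex Xx) (size_vertex Xy).
Proof.
rewrite /Gamma -val_eqE /= /coprime; have [->|ne] /= := eqVneq (cs x) (cs y).
  by rewrite gcdnn neq_ltn class_size_gt1 ?orbT.
have : 0 < gcdn (cs x) (cs y) by rewrite gcdn_gt0 ltnW ?class_size_gt1.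
by case: (gcdn _ _) => [|[]].
Qed.

(** Divisibility gives an inclusion of closed neighbourhoods, and both have [k.+1] elements. *)
Lemma regular_twin :
  regular_graph (@Gamma gT G N) ->
  {in X &, forall x y, cs x %| cs y -> twin x y}.
Proof.
case=> k regG x y Xx Xy xy.
pose nbd z (Xz : z \in X) :=
  size_vertex Xz |: [set w | Gamma (size_vertex Xz) w].
have card_nbd z Xz : #|@nbd z Xz| = k.+1.
  by rewrite cardsU1 -(regG (size_vertex Xz)) inE Gamma_irr.
have nbdE z u (Xz : z \in X) (Xu : u \in X) :
  (size_vertex Xu \in nbd z Xz) = ~~ coprime (cs z) (cs u).
  by rewrite Gamma_coprime !inE eq_sym.
have /eqP eq_nbd : nbd x Xx == nbd y Xy.
  rewrite eqEcard !card_nbd leqnn andbT; apply/subsetP => w.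
  have [z Xz wz] := vertexE w.
  have -> : w = size_vertex Xz by apply: val_inj.
  by rewrite !nbdE; apply: contra; apply: coprime_dvdl.
by apply/twinP => z Xz; apply: negb_inj; rewrite -!nbdE eq_nbd.
Qed.

(** By regularity, the degree of a universal vertex would be shared by all vertices. *)
Lemma no_universal_size :
  ~ complete_graph (@Gamma gT G N) ->
  regular_graph (@Gamma gT G N) ->
  {in X, forall x, exists2 y, y \in X & coprime (cs x) (cs y)}.
Proof.
move=> ncplG [k regG] x Xx; apply/exists_inP; apply/contra_notT: ncplG.
rewrite negb_exists_in => /forall_inP univ.
have degE v : degree (@Gamma gT G N) v <= #|[set~ v]|.
  by apply/subset_leq_card/subsetP => w; rewrite !inE /Gamma eq_sym; case/andP.
have kE : k = #|Gamma_vertex G N|.-1.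
  rewrite -(regG (size_vertex Xx)) -(cardsC1 (size_vertex Xx)).
  apply: eq_card => w; rewrite !inE; have [z Xz wz] := vertexE w.
  have -> : w = size_vertex Xz by apply: val_inj.
  have:= univ z Xz; rewrite Gamma_coprime eq_sym => /orP[/eqP->|gam].
    by rewrite eqxx Gamma_irr.
  by rewrite gam; apply/esym; case/andP: gam => ? _; rewrite eq_sym.
move=> v w ne_vw.
suff /setP/(_ w) : [set u | Gamma v u] = [set~ v].
  by rewrite !inE [w == v]eq_sym ne_vw.
apply/eqP; rewrite eqEcard cardsC1 -kE -(regG v) leqnn andbT.
by apply/subsetP => u; rewrite !inE /Gamma eq_sym; case/andP.
Qed.

Lemma connected_closed (P : pred gT) :
  connected_graph (@Gamma gT G N) ->
  {in X &, forall x y, P x -> ~~ coprime (cs x) (cs y) -> P y} ->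
  {in X &, forall x y, P x -> P y}.
Proof.
move=> conG clP x y Xx Xy Px.
(* [P] lives on elements: a vertex is marked when all elements of that class size satisfy [P]. One
   such element suffices, equal noncentral sizes not being coprime. *)
have : closed (@Gamma gT G N)
   [pred v | [forall (z | (z \in X) && (val v == cs z)), P z]].
  apply: (intro_closed (sym_connect_sym (@Gamma_sym _ _ _))) => v w gam /forall_inP Pv.
  apply/forall_inP => z /andP[Xz /eqP wz].
  have [u Xu vu] := vertexE v.
  have Pu : P u by apply: Pv; rewrite Xu vu /=.
  apply: clP Pu _; rewrite // Gamma_coprime.
  have <- : v = size_vertex Xu by apply: val_inj.
  have <- : w = size_vertex Xz by apply: val_inj.
  by rewrite gam orbT.
move/(closed_connect)/(_ _ _ (conG (size_vertex Xx) (size_vertex Xy))).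
rewrite !inE /=.
have -> : [forall (z | (z \in X) && (cs x == cs z)), P z].
  apply/forall_inP=> z /andP[Xz /eqP xz]; apply: clP Px _ => //.
  by rewrite -xz /coprime gcdnn neq_ltn class_size_gt1 ?orbT.
by move/esym/forall_inP; apply; rewrite Xy eqxx.
Qed.

End Twins.

(** * Elements of prime power order *)

Section Primary.

Variable gT : finGroupType.
Implicit Types (G N : {group gT}) (x y b g : gT).

Lemma constt_nonprime p x : ~~ prime p -> x.`_p = 1.
Proof.
move=> npr; apply/eqP; rewrite -order_eq1 order_constt p_part lognE.
by rewrite (negPf npr).
Qed.

(** An element is the product of its primary parts, which cannot all be central. *)
Lemma noncentral_constt G N x : x \in N :\: 'Z(G) ->
  exists2 p, prime p & x.`_p \in N :\: 'Z(G).
Proof.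
case/setDP=> Nx; have Nxp p : x.`_p \in N by apply: groupX.
pose good p := prime p && (x.`_p \in N :\: 'Z(G)).
have [/hasP[p _ /andP[pr Xp]]|/hasPn nX] := boolP (has good (index_iota 0 #[x].+1)).
  by exists p.
case/negP; rewrite -(prod_constt x) big_seq; apply: group_prod => p /nX.
rewrite negb_and in_setD Nxp andbT negbK => /orP[/constt_nonprime->|//].
exact: group1.
Qed.

Lemma prime_eltM p r x b : p != r -> prime p -> prime r -> p.-elt x -> r.-elt b ->
  commute x b -> (x * b).`_p = x.
Proof.
move=> ne pr_p pr_r px rb cxb; rewrite consttM // constt_p_elt //.
have /constt1P -> : p^'.-elt b by apply: sub_in_pnat rb => q _ /eqnP->; rewrite !inE eq_sym.
by rewrite mulg1.
Qed.

(** Here [[~ x ^+ n, b] = [~ x, b] ^+ n], and likewise for [b], so the order of the commutator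
    divides two coprime orders. *)
Lemma p_elt_commute p r x b : p != r -> prime p -> prime r -> p.-elt x -> r.-elt b ->
  commute x [~ x, b] -> commute b [~ x, b] -> commute x b.
Proof.
move=> ne pr_p pr_r px rb cx cb; apply/commgP.
have dx : #[[~ x, b]] %| #[x] by rewrite order_dvdn -commXg // expg_order comm1g.
have db : #[[~ x, b]] %| #[b] by rewrite order_dvdn -commgX // expg_order commg1.
rewrite -order_eq1 -dvdn1.
have /eqP <- : coprime #[x] #[b].
  by apply: (@pnat_coprime p) px _; apply: sub_in_pnat rb => q _ /eqnP->; rewrite !inE eq_sym.
by rewrite dvdn_gcd dx.
Qed.

(** The index of ['C_G[x]] is prime to [r], so it contains a Sylow [r]-subgroup of [G]. *)
Lemma sylow_commute G r x b : x \in G -> b \in G -> prime r ->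
  ~~ (r %| #|x ^: G|) -> r.-elt b -> exists2 g, g \in G & commute x (b ^ g).
Proof.
move=> Gx Gb pr_r nr rb; have [P sylP] := Sylow_exists r 'C_G[x].
have /and3P[sPC rP iP] := sylP.
have sylPG : r.-Sylow(G) P.
  rewrite /pHall (subset_trans sPC) ?subsetIl //= rP /=.
  by rewrite -(Lagrange_index _ sPC) ?subsetIl // pnatM iP andbT index_cent1 p'natE.
have [||g Gg sbP] := Sylow_Jsub sylPG _ (_ : r.-group <[b]>) => //.
  by rewrite cycle_subG.
exists g => //; have : b ^ g \in 'C_G[x].
  by apply: (subsetP sPC); apply: (subsetP sbP); rewrite memJ_conjg cycle_id.
by case/subcent1P.
Qed.

End Primary.

(** * Noncentral primary elements under the graph conditions *)

Section RegularClassSizes.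

Variables (gT : finGroupType) (G N : {group gT}).
Implicit Types x y z b g : gT.

Local Notation X := (N :\: 'Z(G)).
Local Notation cs x := #|x ^: G|.
Local Notation twin := (twin G N).

Hypothesis nNG : N <| G.
Hypothesis dvd_twin : {in X &, forall x y, cs x %| cs y -> twin x y}.
Hypothesis no_universal :
  {in X, forall x, exists2 y, y \in X & coprime (cs x) (cs y)}.
Hypothesis connected : forall P : pred gT,
  {in X &, forall x y, P x -> ~~ coprime (cs x) (cs y) -> P y} ->
  {in X &, forall x y, P x -> P y}.

Let sNG := normal_sub nNG.

Let XG x : x \in X -> x \in G.
Proof. exact: noncentralG. Qed.

Let XJ x g : x \in X -> g \in G -> x ^ g \in X.
Proof.
move=> Xx Gg; rewrite memJ_norm // -sub1set normsD ?sub1set //.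
  exact: (subsetP (normal_norm nNG)).
by rewrite (subsetP (normal_norm (center_normal G))).
Qed.

Lemma twinJ x g : x \in X -> g \in G -> twin x (x ^ g).
Proof. by move=> Xx Gg; apply: dvd_twin; rewrite ?XJ // class_sizeJ. Qed.

(** Both [x] and [b] are powers of [x * b], so their class sizes divide that of [x * b]. *)
Lemma commute_twin p r x b : p != r -> prime p -> prime r -> x \in X -> b \in X ->
  p.-elt x -> r.-elt b -> commute x b -> twin x b.
Proof.
move=> ne pr_p pr_r Xx Xb px rb cxb.
have xE := prime_eltM ne pr_p pr_r px rb cxb.
have bE : (x * b).`_r = b.
  by rewrite cxb (prime_eltM _ pr_r pr_p rb px) // eq_sym.
have Xxb : x * b \in X.
  have [[Nx nZx] [Nb _]] := (setDP Xx, setDP Xb).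
  by rewrite in_setD (groupM Nx Nb) andbT; apply: contra nZx => Zxb; rewrite -xE groupX.
apply: (@twin_trans _ _ _ (x * b)); first by rewrite dvd_twin // -{1}xE class_size_constt.
by rewrite twin_sym dvd_twin // -{1}bE class_size_constt.
Qed.

Lemma twin_primary x : x \in X ->
  exists p, exists2 y, prime p /\ y \in X & [/\ p.-elt y, cs y %| cs x & twin y x].
Proof.
move=> Xx; have [p pr_p Xp] := noncentral_constt Xx.
exists p, x.`_p => //; split; rewrite ?p_elt_constt ?class_size_constt //.
by apply: dvd_twin; rewrite ?class_size_constt.
Qed.

(* Otherwise [r] divides every class size outside the twin class of [b], so the
   neighbours of [b] outside that class are universal vertices. *)
Lemma not_all_twin r b : prime r -> b \in X -> r.-elt b ->
  exists2 y, y \in X & r.-elt y && ~~ twin b y.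
Proof.
move=> pr_r Xb rb; apply/exists_inP; apply: contraT; rewrite negb_exists_in.
move=> /forall_inP all_tw.
have {}all_tw y : y \in X -> r.-elt y -> twin b y.
  by move=> Xy ry; have := all_tw y Xy; rewrite ry /= negbK.
have r_dvd x : x \in X -> ~~ twin b x -> r %| cs x.
  move=> Xx ntw; have [p [y [pr_p Xy] [py ycs ytw]]] := twin_primary Xx.
  (* If [r] does not divide [cs y], a conjugate of [b] commutes with [y], so [y] is a twin of [b];
     for [p = r] this is the assumption itself. *)
  apply: dvdn_trans ycs; apply: contraR ntw => nr.
  have [g Gg cyb] := sylow_commute (XG Xy) (XG Xb) pr_r nr rb.
  have [eq_pr|ne_pr] := eqVneq p r.
    by apply: twin_trans ytw; apply: all_tw; rewrite // -eq_pr.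
  apply: twin_trans (twinJ Xb Gg) _; apply: twin_trans ytw; rewrite twin_sym.
  by apply: (commute_twin ne_pr); rewrite ?XJ // /p_elt orderJ.
have clT : {in X &, forall x y, twin b x -> ~~ coprime (cs x) (cs y) -> twin b y}.
  move=> x y Xx Xy bx nco; apply: contraT => nby.
  have [z Xz co_yz] := no_universal Xy.
  have [bz|nbz] := boolP (twin b z).
    have /twinP/(_ y Xy) zx : twin z x by apply: twin_trans bx; rewrite twin_sym.
    by move: nco; rewrite -zx coprime_sym co_yz.
  have: r %| gcdn (cs y) (cs z) by rewrite dvdn_gcd !r_dvd.
  by rewrite (eqP co_yz) dvdn1 => /eqP r1; rewrite r1 in pr_r.
have [z Xz co] := no_universal Xb.
have /twinP/(_ z Xz) := connected clT Xb Xz (twin_refl _ _ _).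
have := class_size_gt1 sNG Xz.
by rewrite co /coprime gcdnn; case: (cs z) => [|[]].
Qed.

(** Otherwise every noncentral [r]-element has a conjugate commuting with [x], so all are twins of
    [x], against [not_all_twin]. *)
Lemma prime_dvd_class_size p r x b : p != r -> prime p -> prime r ->
  x \in X -> b \in X -> p.-elt x -> r.-elt b -> r %| cs x.
Proof.
move=> ne pr_p pr_r Xx Xb px rb; apply: contraT => nr.
have tw y : y \in X -> r.-elt y -> twin x y.
  move=> Xy ry; have [g Gg cxy] := sylow_commute (XG Xx) (XG Xy) pr_r nr ry.
  apply: (@twin_trans _ _ _ (y ^ g)); last by rewrite twin_sym twinJ.
  by apply: (commute_twin ne); rewrite ?XJ // /p_elt orderJ.
have [y Xy /andP[ry /negP[]]] := not_all_twin pr_r Xb rb.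
by apply: (@twin_trans _ _ _ x); rewrite ?tw // twin_sym tw.
Qed.

(** As twins, [x] and [b] are both coprime to some [z]. Whatever the prime of a primary part [y] of
    [z], either [r] divides [cs x] and [cs y], or [p] divides [cs b] and [cs y]. *)
Lemma not_commute p r x b : p != r -> prime p -> prime r ->
  x \in X -> b \in X -> p.-elt x -> r.-elt b -> ~ commute x b.
Proof.
move=> ne pr_p pr_r Xx Xb px rb cxb.
have [z Xz co] := no_universal Xx.
have [q [y [pr_q Xy] [qy ycs ytw]]] := twin_primary Xz.
have /twinP/(_ z Xz) := commute_twin ne pr_p pr_r Xx Xb px rb cxb.
rewrite co => /esym co'.
have no_dvd (s k : nat) : prime s -> coprime k (cs z) -> s %| k -> s %| cs y -> False.
  move=> pr_s co_k sk sy; have: s %| gcdn k (cs z).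
    by rewrite dvdn_gcd sk (dvdn_trans sy).
  by rewrite (eqP co_k) dvdn1 => /eqP s1; rewrite s1 in pr_s.
have ne' : r != p by rewrite eq_sym.
have [eq_qp|ne_qp] := eqVneq q p.
  rewrite eq_qp in qy.
  apply: (no_dvd r _ pr_r co).
    exact: prime_dvd_class_size ne pr_p pr_r Xx Xb px rb.
  exact: prime_dvd_class_size ne pr_p pr_r Xy Xb qy rb.
apply: (no_dvd p _ pr_p co').
  exact: prime_dvd_class_size ne' pr_r pr_p Xb Xx rb px.
exact: prime_dvd_class_size ne_qp pr_q pr_p Xy Xx qy px.
Qed.

(* A Sylow [r]-subgroup of [N] would act fixed-point-freely on [W], modulo the
   centre, hence have a single subgroup of order [r], against [not_all_twin]. *)
Lemma pgroup_normal_unique_prime q r (W : {group gT}) b :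
    prime q -> q.-group W -> W <| G -> W \subset N -> ~~ (W \subset 'Z(G)) ->
  prime r -> b \in X -> r.-elt b -> r = q.
Proof.
move=> pr_q qW nWG sWN nZW pr_r Xb rb; apply/eqP; apply: contraT => ne_rq.
pose Z := (N :&: 'Z(G))%G.
have nsZG : Z <| G by rewrite normalI ?center_normal.
have nZ x : x \in N -> x \in 'N(Z).
  by move/(subsetP sNG)/(subsetP (normal_norm nsZG)).
have nZN : N \subset 'N(Z) by apply/subsetP.
have cosetX x : x \in N -> (coset Z x != 1) = (x \in X).
  move=> Nx; have Nx' := nZ x Nx.
  rewrite in_setD Nx andbT; congr negb; apply/eqP/idP => [/(coset_idr Nx')|Zx].
    by case/setIP.
  by apply: coset_id; rewrite inE Nx.
pose V := 'Z(W / Z)%G.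
have abV : abelian V := center_abelian _.
have ntV : V :!=: 1.
  rewrite (center_nil_eq1 (pgroup_nil (quotient_pgroup _ qW))).
  rewrite -subG1 (quotient_sub1 (subset_trans sWN nZN)) /=.
  by apply: contra nZW => /subset_trans; apply; apply: subsetIr.
have nVN x : x \in N -> coset Z x \in 'N(V).
  move=> Nx; apply: subsetP (mem_quotient Z Nx).
  have nWN : N \subset 'N(W) := subset_trans sNG (normal_norm nWG).
  exact: gFnorm_trans (quotient_norms Z nWN).
(* Commuting modulo [Z] makes [[~ x, w]] central; coprime orders then make [x] and [w] commute,
   against [not_commute]. *)
have fpf x : x \in N -> r.-elt x -> coset Z x != 1 -> 'C_V[coset Z x] = 1.
  move=> Nx rx nt; apply/trivgP/subsetP => v /subcent1P[/(subsetP (center_sub _))].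
  case/morphimP=> w nZw Ww -> cxw; have Nw := subsetP sWN w Ww.
  apply/set1gP/eqP; apply: contraT; rewrite cosetX // => Xw.
  rewrite cosetX // in nt.
  have Zxw : [~ x, w] \in 'Z(G).
    have: [~ x, w] \in Z; last by case/setIP.
    apply: coset_idr; first by rewrite groupR ?nZ.
    by rewrite morphR ?nZ //=; apply/eqP/commgP.
  have cZ y : y \in N -> commute y [~ x, w].
    move=> Ny; have /centerP[_ cz] := Zxw.
    exact/commute_sym/cz/(subsetP sNG).
  have qw : q.-elt w := mem_p_elt qW Ww.
  case: (not_commute ne_rq pr_r pr_q nt Xw rx qw).
  by apply: (p_elt_commute ne_rq) => //; apply: cZ.
have [P sylP] := Sylow_exists r N; have [sPN rP _] := and3P sylP.
have toP y : y \in X -> r.-elt y -> exists2 z, z \in X & z \in P /\ twin y z.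
  move=> Xy ry; have [Ny _] := setDP Xy.
  have [||g Ng syP] := Sylow_Jsub sylP _ (_ : r.-group <[y]>) => //.
    by rewrite cycle_subG.
  have Gg := subsetP sNG g Ng.
  exists (y ^ g); [exact: XJ | split; last exact: twinJ].
  by apply: (subsetP syP); rewrite memJ_conjg cycle_id.
have [b0 Xb0 [Pb0 _]] := toP b Xb rb.
have rPZ : r.-group (P / Z) by apply: quotient_pgroup.
have ntPZ : 'Z(P / Z) != 1.
  rewrite (center_nil_eq1 (pgroup_nil rPZ)).
  apply/trivgPn; exists (coset Z b0); first exact: mem_quotient.
  by rewrite cosetX //; case/setDP: Xb0.
(* [x] is taken central of order [r] modulo [Z], so that it can be compared with every element of
   [P]. *)
have [_ r_dv _] := pgroup_pdiv (pgroupS (center_sub _) rPZ) ntPZ.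
have [xb /centerP[/morphimP[x nZx Px ->] cxP] ox] := Cauchy pr_r r_dv.
have Nx := subsetP sPN x Px.
have Xx : x \in X.
  by rewrite -cosetX // -order_gt1 ox prime_gt1.
have twx y : y \in X -> y \in P -> twin y x.
  move=> Xy Py; have Ny := subsetP sPN y Py.
  have ryb : r.-elt (coset Z y) by apply: (mem_p_elt rPZ); apply: mem_quotient.
  have /dvdnP[k ok] : r %| #[coset Z y].
    have := Xy; rewrite -cosetX // -order_eq1.
    by have [[|k] ->] := p_natP ryb; rewrite ?expnS ?dvdn_mulr.
  have oyk : #[coset Z (y ^+ k)] = r.
    rewrite morphX ?nZ // orderXdiv ok ?dvdn_mulr // mulKn //.
    by have := order_gt0 (coset Z y); rewrite ok muln_gt0; case/andP.
  have Nyk : y ^+ k \in N by apply: groupX.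
  have Xyk : y ^+ k \in X by rewrite -cosetX // -order_gt1 oyk prime_gt1.
  have: coset Z x \in <[coset Z (y ^+ k)]>.
    apply: (fpf_cycle abV pr_r ntV); rewrite ?nVN //.
    - rewrite (@pnat_coprime r) ?pnat_id //.
      have qV : q.-group V := pgroupS (center_sub _) (quotient_pgroup _ qW).
      by apply: sub_in_pnat qV => s _ /eqnP->; rewrite !inE eq_sym.
    - by apply: cxP; apply: mem_quotient; apply: groupX.
    - by rewrite -ox expg_order.
    move=> a /mulsgP[_ _ /cycleP[i ->] /cycleP[j ->] ->].
    rewrite -!morphX ?nZ // -morphM ?groupX ?nZ //.
    have Pa : x ^+ i * (y ^+ k) ^+ j \in P by rewrite groupM ?groupX.
    by apply: fpf; [apply: (subsetP sPN) | apply: mem_p_elt Pa].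
  case/cycleP=> j xE.
  apply: (@twin_trans _ _ _ (y ^+ k)).
    by rewrite twin_sym dvd_twin ?class_sizeX.
  (* Up to a central factor, [x] is a power of [y ^+ k]. *)
  rewrite twin_sym dvd_twin //; apply: class_size_dvd.
  have Zxz : x * ((y ^+ k) ^+ j)^-1 \in 'Z(G).
    have: x * ((y ^+ k) ^+ j)^-1 \in Z; last by case/setIP.
    apply: coset_idr; first by rewrite nZ // groupM ?groupV ?groupX.
    by rewrite morphM ?morphV ?morphX ?groupV ?groupX ?nZ //= xE morphX ?nZ // mulgV.
  apply/subsetP => g /subcent1P[Gg cg]; apply/subcent1P; split=> //.
  rewrite -[x](mulgKV ((y ^+ k) ^+ j)); apply/commute_sym/commuteM.
    by have /centerP[_ cz] := Zxz; apply/commute_sym/cz.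
  by apply/commuteX/commute_sym.
have [y Xy /andP[ry /negP[]]] := not_all_twin pr_r Xb rb.
have [[y1 Xy1 [Py1 yy1]] [b1 Xb1 [Pb1 bb1]]] := (toP y Xy ry, toP b Xb rb).
apply: (@twin_trans _ _ _ x); first by apply: twin_trans bb1 _; apply: twx.
by rewrite twin_sym; apply: twin_trans yy1 _; apply: twx.
Qed.

End RegularClassSizes.

(** * A noncentral normal [q]-subgroup, and the conclusion *)

Lemma noncentral_pcore (gT : finGroupType) (G N : {group gT}) : N <| G ->
    (exists x, x \in N :\: 'Z(G)) ->
    {in N :\: 'Z(G), forall x,
      exists2 y, y \in N :\: 'Z(G) & coprime #|x ^: G| #|y ^: G|} ->
  exists q, exists W : {group gT}, [/\ prime q, q.-group W, W <| G, W \subset N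
    & ~~ (W \subset 'Z(G))].
Proof.
move=> nNG [x1 Xx1] no_univ; have sNG := normal_sub nNG.
case: (@arg_maxnP _ 1 (mem N) (fun x => #|x ^: G|) (group1 N)) => x0 /= Nx0 maxx.
have Xx0 : x0 \in N :\: 'Z(G).
  rewrite in_setD Nx0 andbT -class_size_eq1 ?(subsetP sNG) //.
  rewrite neq_ltn (leq_trans (class_size_gt1 sNG Xx1)) ?orbT //.
  by apply: maxx; case/setDP: Xx1.
have [d Xd co] := no_univ _ Xx0; have [q pr_q Xdq] := noncentral_constt Xd.
pose M := <<[set y in N | coprime #|x0 ^: G| #|y ^: G|]>>%G.
have nilM : nilpotent M by apply: max_class_nilpotent => // y; apply: maxx.
have sMN : M \subset N by rewrite gen_subG; apply/subsetP => y /setIdP[].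
have nMG : M <| G.
  by rewrite /normal (subset_trans sMN) //= norms_gen // coprime_class_norm.
have Md : d \in M by rewrite mem_gen // inE co andbT; case/setDP: Xd.
(* Since [M] is nilpotent, ['O_q(M)] contains the noncentral [q]-part of [d]. *)
exists q, 'O_q(M)%G; split=> //; first exact: pcore_pgroup.
- exact: gFnormal_trans.
- exact: subset_trans (pcore_sub _ _) sMN.
case/setDP: Xdq => _; apply: contra => /subsetP; apply.
by rewrite (mem_Hall_pcore (nilpotent_pcore_Hall _ nilM)) ?groupX // p_elt_constt.
Qed.

Theorem theorem1p1 (gT : finGroupType) (G N : {group gT})
    (nNG : N <| G)
    (conG : connected_graph (@Gamma gT G N))
    (regG : regular_graph (@Gamma gT G N))
    (ncplG : ~ complete_graph (@Gamma gT G N)) :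
  (exists2 p : nat, prime p & p.-group (N / (N :&: 'Z(G)))) /\
  'Z(N) <> N :&: 'Z(G).
Proof.
have sNG := normal_sub nNG.
have dvd_tw := regular_twin sNG regG.
have no_univ := no_universal_size sNG ncplG regG.
have conP (P : pred gT) := @connected_closed _ _ _ sNG P conG.
have exX : exists x, x \in N :\: 'Z(G).
  have [/exists_inP[x Xx _]|] := boolP [exists x in N :\: 'Z(G), true].
    by exists x.
  rewrite negb_exists_in => /forall_inP nX; case: ncplG => v.
  by have [x Xx _] := vertexE v; have := nX x Xx.
have [q [W [pr_q qW nWG sWN nZW]]] := noncentral_pcore nNG exX no_univ.
have uniq_q r b : prime r -> b \in N :\: 'Z(G) -> r.-elt b -> r = q.
  exact: (pgroup_normal_unique_prime nNG dvd_tw no_univ conP pr_q qW).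
pose Z := (N :&: 'Z(G))%G.
have nZN : N \subset 'N(Z).
  by rewrite (subset_trans sNG) // normal_norm // normalI ?center_normal.
have qNZ : q.-group (N / Z).
  apply/pgroupP => r pr_r r_dv; case: (Cauchy pr_r r_dv) => _ /morphimP[y nZy Ny ->] oy.
  (* The coset of [y] has order [r], so [y] may be replaced by its [r]-part. *)
  have cyr : coset Z y.`_r = coset Z y.
    by rewrite morph_constt // constt_p_elt // /p_elt oy pnat_id.
  rewrite inE /=; apply/eqP/(uniq_q r y.`_r) => //; last exact: p_elt_constt.
  have Nyr : y.`_r \in N by apply: groupX.
  rewrite in_setD Nyr andbT; apply/negP => Zyr.
  move: oy pr_r; rewrite /= -cyr coset_id ?order1 => [<- //|].
  by rewrite inE Nyr.
split; first by exists q.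
have [x Xx] := exX; have [y Xy co] := no_univ x Xx.
have [z Xz nqz] : exists2 z, z \in N :\: 'Z(G) & ~~ (q %| #|z ^: G|).
  have [qx|] := boolP (q %| #|x ^: G|); last by exists x.
  exists y => //; apply: contraL co => qy; rewrite /coprime neq_ltn orbC.
  rewrite (leq_trans (prime_gt1 pr_q)) // dvdn_leq ?dvdn_gcd ?qx //.
  by rewrite gcdn_gt0 ltnW // (class_size_gt1 sNG Xx).
have [Nz nZz] := setDP Xz; move=> ZNE; case/negP: nZz.
have Gz := subsetP sNG z Nz.
suff: z \in 'Z(N) by rewrite ZNE => /setIP[].
(* [Z] centralises [z], so [#|z ^: N|] is a power of [q]; it divides [#|z ^: G|], which is prime to
   [q], and so equals 1. *)
rewrite -class_size_eq1 //; have: q.-nat #|z ^: N|.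
  apply: pnat_dvd qNZ; rewrite card_quotient // -index_cent1 indexgS //.
  apply/subsetP => c /setIP[Nc /centerP[_ cc]]; apply/subcent1P; split=> //.
  exact/commute_sym/cc.
move/p_natP => [[|k] zk]; first by rewrite zk.
have := class_size_normal Gz nNG; rewrite zk expnS.
by move/(dvdn_trans (dvdn_mulr _ (dvdnn q))); rewrite (negPf nqz).
Qed.
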